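(* Let $n\ge 1$. For every $k\in D_n$, the representations $\tau_{n,c}$ of $S_n$ are isomorphic for all $c\in C_{n,k}$. Furthermore, for distinct $k,k'\in D_n$, the representations $\tau_{n,c}$ and $\tau_{n,c'}$ are non-isomorphic for every $c\in C_{n,k}$ and $c'\in C_{n,k'}$.
   Context: $[n]=\{1,\dots,n\}$. Define $$D_n=\{k \text{ a positive divisor of } n:\ n/k\equiv n \pmod 2\},$$ and for $k\in D_n$ let $C_{n,k}$ be the set of $m\in[n]$ such that $\gcd(n,m)\in\{k,2k\}$ if $\frac nk\equiv 2\pmod 4$, and $\gcd(n,m)=k$ otherwise. $S_n$ is the group of permutations of $[n]$; $\pi_i$ denotes the image of $i$ under $\pi$. $\mathbb{Z}_n$ is the set of integers modulo $n$, with representatives in $\{0,\dots,n-1\}$. An integer sequence $(x_1,\dots,x_m)$ is a parking function of length $m$ if its weakly increasing rearrangement $(z_1,\dots,z_m)$ satisfies $0\le z_i\le i-1$ for $i=1,\dots,m$. $\mathrm{PF}_m$ is the set of parking functions of length $m$ ($\mathrm{PF}_0$ consists of the empty sequence). Entries of elements of $\mathrm{PF}_{n-1}$ lie in $\{0,\dots,n-1\}$ and are viewed as elements of $\mathbb{Z}_n$. For $1\le c\le n$ let $$\widehat{\mathrm{PF}}_{n,c}=\Big\{(x_1,\dots,x_n)\in\mathbb{Z}_n^n:\ (x_1,\dots,x_{n-1})\in\mathrm{PF}_{n-1},\ x_n\equiv c-\sum_{i=1}^{n-1}x_i \pmod n\Big\}.$$ Definition of the $S_n$-action $\tau_{n,c}$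 on $\widehat{\mathrm{PF}}_{n,c}$: for $\pi\in S_n$ and $(x_1,\dots,x_n)\in\widehat{\mathrm{PF}}_{n,c}$, by a theorem of Pollak there is exactly one $y\in\mathbb{Z}_n$ such that $(y+x_{\pi_1},\dots,y+x_{\pi_{n-1}})$ (addition modulo $n$) is in $\mathrm{PF}_{n-1}$; for this $y$ one has $(y+x_{\pi_1},\dots,y+x_{\pi_n})\in\widehat{\mathrm{PF}}_{n,c}$, and one sets $\pi\cdot(x_1,\dots,x_n)=(y+x_{\pi_1},\dots,y+x_{\pi_n})$. Products of permutations are read left to right (first $\pi$, then $\sigma$, in $\pi\sigma$), so that this is a left action. $\tau_{n,c}$ also denotes the associated complex permutation representation of $S_n$, and isomorphism means isomorphism of complex representations. *)

(* Defs.v *)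
From HB Require Import structures.
From mathcomp Require Import all_boot all_order all_algebra all_fingroup.
From mathcomp Require Import mxrepresentation reals complex.
From mathcomp Require zify.

Set Implicit Arguments.
Unset Strict Implicit.
Unset Printing Implicit Defensive.

Import GRing.Theory.
Local Open Scope nat_scope.

Definition D (n : nat) : pred nat :=
  [pred k | [&& 0 < k, k %| n & n %/ k == n %[mod 2]]].

Definition C (n k : nat) : pred nat :=
  [pred m | (1 <= m <= n) &&
     (if n %/ k == 2 %[mod 4] then gcdn n m \in [:: k; 2 * k]
      else gcdn n m == k)].

(* The weakly increasing rearrangement is indexed from 0, so the bound
   "z_i <= i - 1 for i = 1, ..., size s" becomes "z_i <= i for i < size s". *)
Definition parking (s : seq nat) : bool :=
  [forall i : 'I_(size s), nth 0 (sort leq s) i <= i].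

(* From here on n = m.+1 >= 1.  The type 'I_m.+1, with its modular addition
   from zmodp, is Z_n (whereas 'Z_1 would be Z/2); it is also the set of
   positions 1, ..., n, shifted to 0, ..., m. *)
Definition word (m : nat) := {ffun 'I_m.+1 -> 'I_m.+1}.

Definition initial m (x : word m) : seq nat :=
  [seq nat_of_ord (x (widen_ord (leqnSn m) i)) | i <- enum 'I_m].

Definition PFhat (m c : nat) : {set word m} :=
  [set x | parking (initial x) &&
     (x ord_max == inZp c - \sum_(i < m) x (widen_ord (leqnSn m) i))%R].

Definition translate m (y : 'I_m.+1) (x : word m) : word m :=
  [ffun i => (y + x i)%R].

Definition permute m (p : 'S_m.+1) (x : word m) : word m := [ffun i => x (p i)].

Lemma parkingP s :
  reflect (forall i, i <= size s -> i <= count (fun v => v < i) s) (parking s).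
Proof.
set z := sort leq s.
have sz : size z = size s by rewrite size_sort.
have cz i : count (fun v => v < i) s = count (fun v => v < i) z.
  by apply/seq.permP; rewrite perm_sym perm_sort.
have zs : sorted leq z by apply: sort_sorted; apply: leq_total.
apply: (iffP forallP) => [H i lei | H i].
  rewrite cz -(cat_take_drop i z) count_cat.
  apply: leq_trans (leq_addr _ _).
  suff /eqP -> : count (fun v => v < i) (take i z) == size (take i z).
    by rewrite size_takel ?sz.
  rewrite -all_count; apply/(all_nthP 0) => j.
  rewrite size_takel ?sz // => ltj; rewrite nth_take //.
  exact: leq_ltn_trans (H (Ordinal (leq_trans ltj lei))) ltj.
rewrite leqNgt; apply/negP => lti.
have := H i.+1 (ltn_ord i); rewrite cz -(cat_take_drop i z) count_cat.
suff -> : count (fun v => v < i.+1) (drop i z) = 0.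
  rewrite addn0 leqNgt ltnS => /negP; apply.
  by rewrite (leq_trans (count_size _ _)) // size_takel // sz ltnW.
apply/eqP; rewrite -leqn0 leqNgt -has_count; apply/hasPn => v /(nthP 0)[j].
rewrite size_drop sz => ltj <-; rewrite nth_drop -leqNgt.
apply: leq_trans lti _.
apply: (sorted_leq_nth leq_trans leqnn 0 zs); rewrite ?inE ?sz ?leq_addr //.
by rewrite -ltn_subRL.
Qed.

Lemma size_initial m (x : word m) : size (initial x) = m.
Proof. by rewrite size_map size_enum_ord. Qed.

Lemma count_initial m (p : pred nat) (x : word m) :
  count p (initial x) = \sum_(i < m) p (x (widen_ord (leqnSn m) i)).
Proof.
rewrite /initial count_map -sum1_count big_mkcond big_enum /=.
by apply: eq_bigr => i _; case: (p _).
Qed.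

Section Pollak.
Import zify.

Variables (m : nat) (x : word m).

Let a (v : 'I_m.+1) := #|[set i : 'I_m | x (widen_ord (leqnSn m) i) == v]|.
Let A (t : nat) := \sum_(0 <= u < t) a (inZp u).

Let A_period t : A (t + m.+1) = A t + m.
Proof.
have Am : A m.+1 = m.
  rewrite /A big_mkord (eq_bigr a) => [|u _]; last by rewrite valZpK.
  rewrite -[RHS]card_ord -sum1_card.
  rewrite (partition_big (fun i => x (widen_ord (leqnSn m) i)) xpredT) //=.
  by apply: eq_bigr => v _; rewrite /a -sum1_card; apply: eq_bigl => i; rewrite inE.
elim: t => [|t IH]; first by rewrite add0n Am /A big_geq.
rewrite addSn {1}/A big_nat_recr //= -/(A _) IH /A big_nat_recr //= -/(A _).
suff -> : inZp (t + m.+1) = inZp t :> 'I_m.+1 by rewrite addnAC.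
by apply: val_inj; rewrite /= modnDr.
Qed.

Let translate_count (s : 'I_m.+1) i : i <= m.+1 ->
  A (s + i) = A s + count (fun v => v < i) (initial (translate (- s)%R x)).
Proof.
elim: i => [|i IH] lei; first by rewrite addn0 (@eq_count _ _ pred0) ?count_pred0 ?addn0.
rewrite addnS {1}/A big_nat_recr //= -/(A _) IH 1?ltnW // -addnA; congr (_ + _).
rewrite !count_initial /a -sum1_card [X in _ + X]big_mkcond -big_split /=.
apply: eq_bigr => j _; rewrite inE !ffunE.
set w := x _.
have -> : (w == inZp (s + i)) = (nat_of_ord (- s + w)%R == i).
  have -> : inZp (s + i) = (s + inZp i)%R :> 'I_m.+1.
    by apply: val_inj; rewrite /= modnDmr.
  rewrite -(inj_eq (addrI (- s)%R)) addKr -val_eqE [X in _ == X]/= [X in _ == X]modn_small //.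
by rewrite ltnS; case: ltngtP.
Qed.

Lemma pollak_exists : exists y, parking (initial (translate y x)).
Proof.
have [s smin sfirst] : exists2 s : 'I_m.+1,
    (forall t : 'I_m.+1, A s + t <= A t + s) &
    (forall t : 'I_m.+1, t < s -> A s + t < A t + s).
  pose B (t : nat) := A t + (m.+1 - t).
  pose P b := [exists t : 'I_m.+1, B t == b].
  have exP : exists b, P b by exists (B 0); apply/existsP; exists ord0.
  case: (ex_minnP exP) => b /existsP[t0 /eqP Bt0] bmin.
  pose Q k := (k < m.+1) && (B k == b).
  have exQ : exists k, Q k by exists t0; rewrite /Q ltn_ord Bt0 /=.
  case: (ex_minnP exQ) => k /andP[ltk /eqP Bk] kmin.
  have Bmin (t : 'I_m.+1) : b <= B t by apply: bmin; apply/existsP; exists t.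
  exists (Ordinal ltk) => t /=.
    by have := Bmin t; rewrite -Bk /B; have := ltn_ord t; lia.
  move=> lttk; have := Bmin t; rewrite leq_eqVlt => /orP[/eqP bE | ].
    have : k <= t by apply: kmin; rewrite /Q ltn_ord -bE /=.
    by rewrite leqNgt lttk.
  by rewrite -Bk /B; have := ltn_ord t; lia.
exists (- s)%R; apply/parkingP => i; rewrite size_initial => lei.
have := translate_count s (leqW lei).
case: (ltnP (s + i) m.+1) => [lts | ges].
  by have := smin (Ordinal lts) => /=; lia.
have ltj : s + i - m.+1 < m.+1 by have := ltn_ord s; lia.
have := sfirst (Ordinal ltj) => /=.
have -> : A (s + i) = A (s + i - m.+1) + m by rewrite -A_period subnK.
by have := ltn_ord s; lia.
Qed.

Lemma pollak_unique y y' :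
  parking (initial (translate y x)) -> parking (initial (translate y' x)) ->
  y = y'.
Proof.
suff H (s s' : 'I_m.+1) : parking (initial (translate (- s)%R x)) ->
    parking (initial (translate (- s')%R x)) -> s < s' -> False.
  rewrite -(opprK y) -(opprK y').
  move: (- y)%R (- y')%R => s s' Hs Hs'; congr (- _)%R.
  case: (ltngtP s s') => [lt|lt|/val_inj //]; last by case: (H s' s).
  by case: (H s s').
move=> /parkingP Hs /parkingP Hs' lt; rewrite !size_initial in Hs Hs'.
have lts' := ltn_ord s'.
have i1 : s' - s <= m by lia.
have i2 : s + m.+1 - s' <= m by lia.
have := Hs _ i1; have := Hs' _ i2.
have := translate_count s (leqW i1); have := translate_count s' (leqW i2).
have -> : s' + (s + m.+1 - s') = s + m.+1 by lia.
have -> : s + (s' - s) = s' by lia.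
by rewrite A_period; lia.
Qed.

End Pollak.

Definition pollak_shift m (x : word m) : 'I_m.+1 := xchoose (pollak_exists x).

Definition act_word m (p : 'S_m.+1) (x : word m) : word m :=
  translate (pollak_shift (permute p x)) (permute p x).

Lemma PFhatE m c (x : word m) :
  (x \in PFhat m c) = parking (initial x) && (\sum_i x i == inZp c)%R.
Proof. by rewrite inE big_ord_recr /= [in RHS]addrC eq_sym subr_eq eq_sym. Qed.

Lemma act_word_PFhat m c (p : 'S_m.+1) (x : word m) :
  x \in PFhat m c -> act_word p x \in PFhat m c.
Proof.
rewrite !PFhatE => /andP[_ /eqP sx]; apply/andP; split.
  exact: (xchooseP (pollak_exists (permute p x))).
rewrite -sx [X in _ == X](reindex_inj (@perm_inj _ p)) /=; apply/eqP.
under eq_bigr => i _ do rewrite !ffunE.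
rewrite big_split /= sumr_const card_ord.
have -> : (pollak_shift (permute p x) *+ m.+1 = 0)%R; last by rewrite add0r.
by apply: val_inj; rewrite Zp_mulrn /= modnMl.
Qed.

Definition PFhat_type (m c : nat) := {x : word m | x \in PFhat m c}.

Definition tau_act m c (p : 'S_m.+1) (x : PFhat_type m c) : PFhat_type m c :=
  Sub (act_word p (val x)) (act_word_PFhat p (valP x)).

Lemma tau_act1 m c (x : PFhat_type m c) : tau_act 1%g x = x.
Proof.
apply: val_inj; rewrite /= /act_word.
have -> : permute 1 (val x) = val x by apply/ffunP => i; rewrite ffunE perm1.
have t0 : translate 0%R (val x) = val x by apply/ffunP => i; rewrite ffunE add0r.
rewrite (_ : pollak_shift _ = 0%R) //.
apply: (@pollak_unique _ (val x)); first exact: (xchooseP (pollak_exists _)).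
by rewrite t0; have := valP x; rewrite PFhatE => /andP[].
Qed.

(* In perm, (s * p)%g applies s first. *)
Lemma tau_actM m c (s p : 'S_m.+1) (x : PFhat_type m c) :
  tau_act (s * p)%g x = tau_act s (tau_act p x).
Proof.
apply: val_inj; rewrite /= /act_word.
set y := pollak_shift (permute p _); set y' := pollak_shift (permute s _).
have E z : translate z (permute s (translate y (permute p (val x)))) =
           translate (z + y)%R (permute (s * p)%g (val x)).
  by apply/ffunP => i; rewrite !ffunE permM addrA.
rewrite E; congr translate.
apply: (@pollak_unique _ (permute (s * p)%g (val x))).
  exact: (xchooseP (pollak_exists _)).
rewrite -E; exact: (xchooseP (pollak_exists _)).
Qed.

(* Matrix of the permutation of the standard basis given by a left action,
   column j being the image of the j-th basis vector. *)
Definition left_perm_mx (F : fieldType) (gT : finGroupType) (T : finType)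
    (act : gT -> T -> T) (g : gT) : 'M[F]_#|T| :=
  \matrix_(i, j) ((enum_val i == act g (enum_val j))%:R)%R.

Lemma left_perm_mx_repr (F : fieldType) (gT : finGroupType) (T : finType)
    (act : gT -> T -> T) (act1 : forall x, act 1%g x = x)
    (actM : forall g h x, act (g * h)%g x = act g (act h x)) :
  mx_repr [set: gT] (left_perm_mx F act).
Proof.
split=> [|g h _ _]; apply/matrixP=> i j; rewrite !mxE.
  by rewrite act1 (inj_eq enum_val_inj).
rewrite (bigD1 (enum_rank (act h (enum_val j)))) //= !mxE enum_rankK eqxx mulr1.
rewrite big1 ?addr0 ?actM // => k; rewrite !mxE -(inj_eq enum_val_inj) enum_rankK.
by move=> /negPf ->; rewrite mulr0.
Qed.

Definition tau (R : realType) (m c : nat) :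
    mx_representation R[i]%C [set: 'S_m.+1] #|{: PFhat_type m c}| :=
  MxRepresentation
    (left_perm_mx_repr R[i]%C (@tau_act1 m c) (@tau_actM m c)).

(* Main.v *)
(* PFhat m c represents the words of sum c in Z_n^n modulo translation by
   constants, so S_n acts on it by permuting positions.

   Isomorphisms. Scaling words by a unit u mod n is an equivariant bijection
   from sum c to sum u c, which settles the case gcd(n,c) = gcd(n,c'). When n is
   even, let zeta be a primitive 2n-th root of unity; the Gauss kernel
   K(a,b) = zeta^(sum_i (b_i - a_i)^2) commutes with S_n, it is invariant under
   translations of a and b exactly when the sums of a and b differ by n/2, and
   it is inverted by the conjugate kernel. Hence tau_{n,c} and tau_{n,c+n/2} are
   isomorphic, and adding n/2 exchanges gcd k and gcd 2k when n/k = 2 mod 4.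

   Non-isomorphism. For k in D_n let p be the rotation i -> i + n/k of the
   positions, all of whose cycles have length k. If p fixes the class of x, then
   x(p i) = x(i) + y, so the sum of x is a multiple of k plus
   y (n/k) k(k-1)/2, and n/k = n mod 2 makes k divide this last term too. So the
   character of tau_{n,c} at p is nonzero iff k | c, and k is recovered from these
   divisibilities. *)

Require Import Defs.
From mathcomp Require Import all_boot all_order all_algebra all_fingroup.
From mathcomp Require Import mxrepresentation reals complex.
From mathcomp Require Import cyclic separable cyclotomic zify.

Set Implicit Arguments.
Unset Strict Implicit.
Unset Printing Implicit Defensive.

Import Order.TTheory GRing.Theory Num.Theory.
Local Open Scope ring_scope.

(** * Units modulo n and gcds *)

Lemma modn_inverse (u n : nat) :
  (0 < n)%N -> coprime u n -> exists v, (u * v = 1 %[mod n])%N.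
Proof.
move=> n_gt0 co_u; case: (posnP u) => [u0 | u_gt0].
  by exists 0%N; move: co_u; rewrite u0 /coprime gcd0n => /eqP->; rewrite !modn1.
case/(coprimeP _ u_gt0): co_u => -[v w] /= vw; exists v.
by have -> : (u * v = w * n + 1)%N; [lia | rewrite modnMDl].
Qed.

(** Chinese remaindering: take u to be a mod d and 1 mod q, where q is the part of n prime to d;
    every prime of n divides d or q. *)
Lemma coprime_lift (a d n : nat) :
  (0 < n)%N -> (d %| n)%N -> coprime a d ->
  exists2 u, coprime u n & (u = a %[mod d])%N.
Proof.
move=> n_gt0 dn co_a; have d_gt0 := dvdn_gt0 n_gt0 dn.
set q := (n`_(\pi(d)^'))%N.
have co_dq : coprime d q by rewrite coprime_pi' ?part_gt0 ?part_pnat.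
(* The summand [d * q] only makes u positive, as [coprime_pi'] requires. *)
pose u := (chinese d q a 1 + d * q)%N.
have u_gt0 : (0 < u)%N by rewrite addn_gt0 muln_gt0 d_gt0 part_gt0 orbT.
have ua : (u = a %[mod d])%N by rewrite /u mulnC addnC modnMDl chinese_modl.
have u1 : (u = 1 %[mod q])%N by rewrite /u addnC modnMDl chinese_modr.
exists u => //; rewrite -(partnC \pi(d) n_gt0) coprimeMr; apply/andP; split.
  rewrite coprime_sym; apply: (pnat_coprime (part_pnat _ _)).
  by rewrite -coprime_pi' // coprime_sym -coprime_modl ua coprime_modl.
by rewrite -coprime_modl u1 coprime_modl coprime1n.
Qed.

(** With g the common gcd, c = s g, c' = s' g and n = d g, both s and s' are units mod d; lift s'/s
    to a unit mod n. *)
Lemma eq_gcdn_unit (n c c' : nat) :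
  (0 < n)%N -> gcdn n c = gcdn n c' ->
  exists2 u, coprime u n & (c * u = c' %[mod n])%N.
Proof.
move=> n_gt0 egcd; set g := gcdn n c in egcd.
have g_gt0 : (0 < g)%N by rewrite gcdn_gt0 n_gt0.
have /dvdnP[d nE] : (g %| n)%N by apply: dvdn_gcdl.
have /dvdnP[s cE] : (g %| c)%N by apply: dvdn_gcdr.
have /dvdnP[s' c'E] : (g %| c')%N by rewrite egcd dvdn_gcdr.
have d_gt0 : (0 < d)%N by move: n_gt0; rewrite nE muln_gt0 => /andP[].
have co r : gcdn n (r * g) = g -> coprime r d.
  rewrite nE -muln_gcdl => /eqP; rewrite -[X in _ == X]mul1n eqn_pmul2r //.
  by rewrite coprime_sym.
have co_s : coprime s d by apply: co; rewrite -cE.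
have co_s' : coprime s' d by apply: co; rewrite -c'E.
have [v sv] := modn_inverse d_gt0 co_s.
have co_v : coprime v d.
  have : coprime (s * v) d by rewrite -coprime_modl sv coprime_modl coprime1n.
  by rewrite coprimeMl => /andP[].
have dn : (d %| n)%N by rewrite nE dvdn_mulr.
have co_vs' : coprime (v * s') d by rewrite coprimeMl co_v.
have [u co_u uE] := coprime_lift n_gt0 dn co_vs'.
exists u => //; rewrite cE c'E nE mulnAC -!muln_modl; congr (_ * _)%N.
by rewrite -modnMmr uE modnMmr mulnA -modnMml sv modnMml mul1n.
Qed.

(** * Intertwiners of permutation representations *)

Lemma mx_rsim_of_row_free (F : fieldType) (gT : finGroupType) (G : {group gT})
    (n1 n2 : nat) (r1 : mx_representation F G n1)
    (r2 : mx_representation F G n2) (A : 'M[F]_(n1, n2)) (B : 'M[F]_(n2, n1)) :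
  row_free A -> row_free B -> {in G, forall g, r1 g *m A = A *m r2 g} ->
  mx_rsim r1 r2.
Proof.
move=> fA fB hA; apply: (MxReprSim _ fA hA); apply/eqP; rewrite eqn_leq.
by rewrite -{1}(eqP fA) rank_leq_col -(eqP fB) rank_leq_col.
Qed.

Lemma mx_rsim_mxtrace (F : fieldType) (gT : finGroupType) (G : {group gT})
    (n1 n2 : nat) (r1 : mx_representation F G n1)
    (r2 : mx_representation F G n2) :
  mx_rsim r1 r2 -> {in G, forall g, \tr (r1 g) = \tr (r2 g)}.
Proof.
case=> B en; case: n2 / en r2 B => r2 B; rewrite row_free_unit => uB hB g Gg.
by rewrite -(mulmxK uB (r1 g)) hB // mxtrace_mulC mulKmx.
Qed.

Section PermutationRepresentations.
Variables (F : fieldType) (gT : finGroupType).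

Lemma mxtrace_left_perm_mx (T : finType) (act : gT -> T -> T) g :
  \tr (left_perm_mx F act g) = #|[pred x | act g x == x]|%:R.
Proof.
rewrite /mxtrace (eq_bigr (fun i => (act g (enum_val i) == enum_val i)%:R)).
  rewrite (reindex enum_rank) /=; last exact/onW_bij/enum_rank_bij.
  under eq_bigr do rewrite enum_rankK.
  by rewrite -natr_sum -sum1_card [in RHS]big_mkcond.
by move=> i _; rewrite mxE eq_sym.
Qed.

Variables (T1 T2 : finType) (act1 : gT -> T1 -> T1) (act2 : gT -> T2 -> T2).
Hypothesis act1_1 : forall x, act1 1%g x = x.
Hypothesis act1M : forall g h x, act1 (g * h)%g x = act1 g (act1 h x).

Definition kernel_mx (S1 S2 : finType) (K : S1 -> S2 -> F) : 'M[F]_(#|S1|, #|S2|) :=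
  \matrix_(i, j) K (enum_val i) (enum_val j).

(** At (a, b) the two products collapse to K(g^-1 a, b) and K(a, g b), which agree by invariance. *)
Lemma kernel_mx_intertwines (K : T1 -> T2 -> F) g :
  (forall a b, K (act1 g a) (act2 g b) = K a b) ->
  left_perm_mx F act1 g *m kernel_mx K = kernel_mx K *m left_perm_mx F act2 g.
Proof.
move=> Kg; apply/matrixP => i j; rewrite !mxE.
rewrite (bigD1 (enum_rank (act1 g^-1 (enum_val i)))) //= !mxE enum_rankK.
rewrite -act1M mulgV act1_1 eqxx mul1r big1 ?addr0 => [|k]; last first.
  rewrite !mxE -(inj_eq enum_val_inj) enum_rankK => kP.
  case: eqP => [e|_]; last by rewrite mul0r.
  by rewrite e -act1M mulVg act1_1 eqxx in kP.
rewrite (bigD1 (enum_rank (act2 g (enum_val j)))) //= !mxE enum_rankK eqxx mulr1.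
rewrite big1 ?addr0 => [|k]; last first.
  by rewrite !mxE -(inj_eq enum_val_inj) enum_rankK => /negPf->; rewrite mulr0.
by rewrite -[in RHS](act1_1 (enum_val i)) -(mulgV g) act1M Kg.
Qed.

End PermutationRepresentations.

Lemma kernel_mx_row_free (F : fieldType) (S1 S2 : finType) (K : S1 -> S2 -> F)
    (K' : S2 -> S1 -> F) (l : F) :
  l != 0 -> (forall a a', \sum_b K a b * K' b a' = l *+ (a == a')) ->
  row_free (kernel_mx K).
Proof.
move=> l0 KK; apply/row_freeP; exists (l^-1 *: kernel_mx K').
apply/matrixP => i j; rewrite -scalemxAr !mxE (reindex enum_rank) /=; last first.
  exact/onW_bij/enum_rank_bij.
under eq_bigr do rewrite !mxE enum_rankK.
by rewrite KK (inj_eq enum_val_inj) mulrnAr mulVf.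
Qed.

(** Since n is invertible, X^n - 1 is separable, so it has n distinct roots, and [has_prim_root]
    applies. *)
Lemma closed_prim_root (F : closedFieldType) (n : nat) :
  n%:R != 0 :> F -> exists z : F, n.-primitive_root z.
Proof.
move=> n0; have n_gt0: (0 < n)%N by case: n n0 => //; rewrite eqxx.
have [r Dp] := closed_field_poly_normal ('X^n - 1 : {poly F}).
have {Dp} Dp : 'X^n - 1 = \prod_(z <- r) ('X - z%:P).
  by rewrite Dp lead_coefXnsubC // scale1r.
have sz : size r = n.
  by apply/succn_inj; rewrite -(size_prod_XsubC r id) -Dp size_XnsubC.
have /hasP[z _ pz] : has n.-primitive_root r; last by exists z.
apply: has_prim_root; rewrite ?sz //.
- by apply/allP => z; rewrite -root_prod_XsubC -Dp => /unity_rootP zn; apply/unity_rootP.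
- by rewrite -separable_prod_XsubC -Dp separable_Xn_sub_1.
Qed.

(** * Words modulo translation *)

Section Words.
Variable m : nat.
Implicit Types (x z : word m) (y s t : 'I_m.+1) (p : 'S_m.+1).

Lemma translate0 x : translate 0 x = x.
Proof. by apply/ffunP => i; rewrite ffunE add0r. Qed.

Lemma translateD s t x : translate s (translate t x) = translate (s + t) x.
Proof. by apply/ffunP => i; rewrite !ffunE addrA. Qed.

Lemma translate_inj s : injective (@translate m s).
Proof.
by apply: (can_inj (g := translate (- s))) => x; rewrite translateD addNr translate0.
Qed.

Lemma translateB s t x z :
  translate s x - translate t z = translate (s - t) (x - z).
Proof. by apply/ffunP => i; rewrite !ffunE opprD addrACA. Qed.

Lemma translateMn t x u :
  translate t x *+ u = translate (t *+ u) (x *+ u).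
Proof. by apply/ffunP => i; rewrite !(ffunE, ffunMnE) mulrnDl. Qed.

Lemma permute_translate p t x :
  permute p (translate t x) = translate t (permute p x).
Proof. by apply/ffunP => i; rewrite !ffunE. Qed.

Lemma mulr_modulus y : y *+ m.+1 = 0.
Proof. by apply: val_inj; rewrite Zp_mulrn /= modnMl. Qed.

Lemma sum_translate t x : \sum_i translate t x i = \sum_i x i.
Proof.
under eq_bigr do rewrite ffunE.
by rewrite big_split /= sumr_const card_ord mulr_modulus add0r.
Qed.

Lemma sum_word_sub x z : \sum_i (x - z) i = \sum_i x i - \sum_i z i.
Proof. by under eq_bigr do rewrite !ffunE; rewrite big_split /= sumrN. Qed.

Lemma sum_permute p x : \sum_i permute p x i = \sum_i x i.
Proof.
by under eq_bigr do rewrite ffunE; rewrite [RHS](reindex_inj (@perm_inj _ p)).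
Qed.

(** The canonical representative of a translation class; [act_word p x] unfolds to
    [normalize (permute p x)]. *)
Definition normalize x : word m := translate (pollak_shift x) x.

Lemma parking_normalize x : parking (initial (normalize x)).
Proof. exact: (xchooseP (pollak_exists x)). Qed.

Lemma parking_translate_eq t x :
  parking (initial x) -> parking (initial (translate t x)) -> translate t x = x.
Proof.
move=> px pt; rewrite -[RHS]translate0; congr translate.
by apply: pollak_unique pt _; rewrite translate0.
Qed.

Lemma normalize_translate t x : normalize (translate t x) = normalize x.
Proof.
suff /(parking_translate_eq (parking_normalize x)) :
  parking (initial (translate (pollak_shift (translate t x) + t - pollak_shift x)
    (normalize x))) by rewrite translateD subrK -translateD.
by rewrite translateD subrK -translateD; apply: parking_normalize.
Qed.

Lemma normalize_PFhat c x : \sum_i x i = inZp c -> normalize x \in PFhat m c.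
Proof. by move=> sx; rewrite PFhatE parking_normalize sum_translate sx eqxx. Qed.

Lemma PFhat_parking c (a : PFhat_type m c) : parking (initial (val a)).
Proof. by have := valP a; rewrite PFhatE => /andP[]. Qed.

Lemma PFhat_sum c (a : PFhat_type m c) : \sum_i val a i = inZp c.
Proof. by have := valP a; rewrite PFhatE => /andP[_ /eqP]. Qed.

Lemma tau_actK c p : cancel (@tau_act m c p) (tau_act p^-1%g).
Proof. by move=> a; rewrite -tau_actM mulVg tau_act1. Qed.

(* Every translation class of words contains exactly one element of PFhat. *)
Lemma sum_PFhat (V : nmodType) c (h : word m -> V) :
  (forall t x, h (translate t x) = h x) ->
  \sum_(x : word m | \sum_i x i == inZp c) h x =
  (\sum_(a : PFhat_type m c) h (val a)) *+ m.+1.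
Proof.
move=> ht.
transitivity (\sum_(x : word m | \sum_i x i == inZp c)
    \sum_(s | parking (initial (translate s x))) h x).
  apply: eq_bigr => x _; rewrite (bigD1 (pollak_shift x)) ?parking_normalize //=.
  rewrite big1 ?addr0 // => s /andP[ps /eqP[]].
  by apply: pollak_unique ps _; apply: parking_normalize.
rewrite (exchange_big_dep xpredT) //=.
rewrite [RHS](_ : _ = \sum_(s < m.+1) \sum_(a : PFhat_type m c) h (val a)); last first.
  by rewrite sumr_const card_ord.
apply: eq_bigr => s _; rewrite -big_sub /= [RHS](reindex_inj (@translate_inj s)) /=.
by apply: eq_big => x; rewrite ?ht // PFhatE sum_translate andbC.
Qed.

End Words.

(** * Scaling words by a unit *)

Section UnitScaling.
Variables (m u c c' : nat).
Hypotheses (co_u : coprime u m.+1) (cc' : (c * u = c' %[mod m.+1])%N).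

Lemma scale_PFhat_subproof (a : PFhat_type m c) :
  normalize (val a *+ u) \in PFhat m c'.
Proof.
apply: normalize_PFhat; under eq_bigr do rewrite ffunMnE.
rewrite sumrMnl PFhat_sum; apply: val_inj.
by rewrite Zp_mulrn /= modnMml mulnC mulnC cc'.
Qed.

Definition scale_PFhat (a : PFhat_type m c) : PFhat_type m c' :=
  Sub (normalize (val a *+ u)) (scale_PFhat_subproof a).

Lemma tau_act_scale_PFhat p a :
  tau_act p (scale_PFhat a) = scale_PFhat (tau_act p a).
Proof.
apply: val_inj => /=; transitivity (normalize (permute p (val a *+ u))).
  by rewrite /act_word -/(normalize _) permute_translate normalize_translate.
rewrite translateMn normalize_translate; congr normalize.
by apply/ffunP => i; rewrite !(ffunE, ffunMnE).
Qed.

Lemma scale_PFhat_inj : injective scale_PFhat.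
Proof.
move=> a b /(congr1 val) /= eab.
have [v uv] := modn_inverse (ltn0Sn m) co_u.
have mulK (y : 'I_m.+1) : y *+ u *+ v = y.
  rewrite -mulrnA; apply: val_inj; rewrite Zp_mulrn /= -modnMmr uv modnMmr muln1.
  by rewrite modn_small.
suff [t e] : exists t, val a = translate t (val b).
  by apply/val_inj; rewrite e; apply: parking_translate_eq;
    rewrite -?e; apply: PFhat_parking.
(* The scaled words differ by the difference of their Pollak shifts; multiplying by v, the inverse
   of u, undoes the scaling. *)
exists ((pollak_shift (val b *+ u) - pollak_shift (val a *+ u)) *+ v).
apply/ffunP => i; move/ffunP/(_ i): eab; rewrite !(ffunE, ffunMnE) => e.
by rewrite -[LHS]mulK -(mulK (val b i)) -mulrnDl addrAC -e addrC addKr.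
Qed.

End UnitScaling.

(** * The Gauss kernel for even n *)

Section GaussKernel.
Variables (F : numClosedFieldType) (m h : nat) (z : F).
Hypotheses (mh : m.+1 = h.*2) (prim_z : (m.+1.*2).-primitive_root z).
Implicit Types (v w t : 'I_m.+1) (x : word m).

Let z_neq0 : z != 0.
Proof.
apply: contra_eq_neq (prim_expr_order prim_z) => ->.
by rewrite doubleS expr0n eq_sym oner_eq0.
Qed.

Let expz i k : z ^+ (i + m.+1.*2 * k) = z ^+ i.
Proof. by rewrite exprD exprM (prim_expr_order prim_z) expr1n mulr1. Qed.

Definition add_char v : F := z ^+ v.*2.
Definition gauss v : F := z ^+ (v ^ 2).

Lemma add_char_inZp j : add_char (inZp j) = z ^+ j.*2.
Proof.
rewrite /add_char /= -(expz _ (j %/ m.+1)); congr (z ^+ _).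
by rewrite {3}(divn_eq j m.+1); lia.
Qed.

(** [gauss] is well defined mod n because n = 2h: (qn + r)^2 = r^2 + 2n(qr + q^2 h), and z has order
    2n. *)
Lemma gauss_inZp j : gauss (inZp j) = z ^+ (j ^ 2).
Proof.
rewrite /gauss /=; set r := (j %% _)%N; set q := (j %/ m.+1)%N.
rewrite -(expz _ (q * r + q ^ 2 * h)); congr (z ^+ _).
have -> : j = (q * m.+1 + r)%N by apply: divn_eq.
by rewrite mh -!mul2n; lia.
Qed.

Lemma add_charD v w : add_char (v + w) = add_char v * add_char w.
Proof. by rewrite [LHS]add_char_inZp doubleD exprD. Qed.

Lemma add_char0 : add_char 0 = 1.
Proof. by rewrite /add_char expr0. Qed.

Lemma add_char_sum x : add_char (\sum_i x i) = \prod_i add_char (x i).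
Proof. by apply: (big_morph _ add_charD add_char0). Qed.

Lemma gaussD v w : gauss (v + w) = gauss v * gauss w * add_char v ^+ w.
Proof.
by rewrite [LHS]gauss_inZp /gauss /add_char -exprM -!exprD; congr (z ^+ _); lia.
Qed.

Lemma gauss_neq0 v : gauss v != 0.
Proof. exact: expf_neq0. Qed.

(** Orthogonality of characters: for w nonzero this is a geometric sum whose ratio is an n-th root
    of unity other than 1. *)
Lemma sum_add_charX w : \sum_(t < m.+1) add_char w ^+ t = m.+1%:R *+ (w == 0).
Proof.
have [-> | w0] := eqVneq w 0.
  under eq_bigr do rewrite add_char0 expr1n.
  by rewrite sumr_const card_ord.
have e1 : add_char w - 1 != 0.
  rewrite subr_eq0 -(prim_order_dvd prim_z) -!mul2n dvdn_pmul2l //.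
  apply: contra w0 => /dvdnP[k wk]; rewrite -val_eqE /= wk.
  by have := ltn_ord w; rewrite wk; case: k {wk} => //; lia.
apply: (mulfI e1); rewrite -subrX1 mulr0; apply/eqP; rewrite subr_eq0.
have -> : add_char w ^+ m.+1 = z ^+ (0 + m.+1.*2 * w).
  by rewrite /add_char -exprM; congr (z ^+ _); lia.
by rewrite expz.
Qed.

(** After t is shifted by w, [gaussD] turns the ratio into a constant times the character t ->
    [add_char (w - v) ^+ t]. *)
Lemma sum_gauss_ratio v w :
  \sum_t gauss (t - v) / gauss (t - w) = m.+1%:R *+ (v == w).
Proof.
rewrite (reindex_inj (addIr w)) /=.
transitivity (\sum_(t < m.+1) gauss (w - v) * add_char (w - v) ^+ t).
  apply: eq_bigr => t _; rewrite addrK -addrA [t + _]addrC (gaussD (w - v) t) mulrAC.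
  by rewrite mulfK ?gauss_neq0.
rewrite -mulr_sumr sum_add_charX subr_eq0 eq_sym.
by case: eqP => [-> | _]; rewrite ?mulr0 // subrr /gauss expr0 mul1r.
Qed.

Definition gauss_word x : F := \prod_i gauss (x i).

(** The n factors [gauss t] multiply to z^(n t^2) = (z^n)^t, since t^2 and t have the same parity;
    z^n is [add_char (inZp h)], whence the shift by n/2. *)
Lemma gauss_word_translate t x :
  gauss_word (translate t x) = gauss_word x * add_char (\sum_i x i + inZp h) ^+ t.
Proof.
rewrite /gauss_word; under eq_bigr do rewrite ffunE addrC gaussD -mulrA.
rewrite big_split /=; congr (_ * _); rewrite big_split /= prodr_const card_ord.
rewrite prodrXl -add_char_sum addrC add_charD exprMn; congr (_ * _).
rewrite add_char_inZp /gauss -!exprM; move: (nat_of_ord t) => j.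
have [k ->] : exists k, (j ^ 2 = j + k.*2)%N.
  by elim: j => [|j [k jk]]; [exists 0%N | exists (k + j)%N; lia].
by rewrite -(expz (h.*2 * j) k); congr (z ^+ _); rewrite mh; lia.
Qed.

Lemma sum_gauss_word_ratio x (y : word m) :
  \sum_(w : word m) gauss_word (w - x) / gauss_word (w - y) =
  m.+1%:R ^+ m.+1 *+ (x == y).
Proof.
transitivity (\sum_(w : word m) \prod_i (gauss (w i - x i) / gauss (w i - y i))).
  apply: eq_bigr => w _; rewrite /gauss_word -prodfV -big_split /=.
  by apply: eq_bigr => i _; rewrite !ffunE.
rewrite -(bigA_distr_bigA (fun i v => gauss (v - x i) / gauss (v - y i))) /=.
under eq_bigr do rewrite sum_gauss_ratio.
have [-> | /eqP/ffunP nxy] := eqVneq x y.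
  by under eq_bigr do rewrite eqxx; rewrite prodr_const card_ord.
have [i /negPf ni] : exists i, x i != y i.
  by apply/existsP; rewrite -negb_forall; apply/forallP => e; apply: nxy => i; apply/eqP.
by rewrite (bigD1 i) //= ni mul0r.
Qed.

Variables c c' : nat.
Hypothesis cc' : inZp c' = inZp c + inZp h :> 'I_m.+1.

Definition gauss_kernel (a : PFhat_type m c) (b : PFhat_type m c') : F :=
  gauss_word (val b - val a).

Let hh : inZp h + inZp h = 0 :> 'I_m.+1.
Proof. by apply: val_inj; rewrite /= modnDm addnn -mh modnn. Qed.

(** The entries of b - a sum to h and h + h = 0, so the translation factor is 1. *)
Lemma gauss_kernel_tau_act p a b :
  gauss_kernel (tau_act p a) (tau_act p b) = gauss_kernel a b.
Proof.
rewrite /gauss_kernel /= /act_word translateB gauss_word_translate.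
rewrite sum_word_sub !sum_permute !PFhat_sum cc' addrAC -(addrA (inZp c)) hh addr0 subrr.
rewrite add_char0 expr1n mulr1 /gauss_word [RHS](reindex_inj (@perm_inj _ p)) /=.
by apply: eq_bigr => i _; rewrite !ffunE.
Qed.

(* Averaging over the translates of [a] selects the words of sum [c']. *)
Lemma sum_gauss_kernel a a' :
  \sum_b gauss_kernel a b / gauss_word (val b - val a') =
  (m.+1%:R ^+ m.+1 / m.+1%:R ^+ 2) *+ (a == a').
Proof.
have n0 : m.+1%:R != 0 :> F by rewrite pnatr_eq0.
pose f (x : word m) := gauss_word (x - val a) / gauss_word (x - val a').
have ft t x : f (translate t x) = f x.
  have sub0 u : translate t x - u = translate t (x - u).
    by rewrite -{1}(translate0 u) translateB subr0.
  rewrite /f !sub0 !gauss_word_translate !sum_word_sub !PFhat_sum.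
  rewrite -mulf_div divff ?mulr1 // expf_neq0 //.
  exact: expf_neq0.
(* One factor n counts the translates of b, the other those of a. *)
have : (\sum_(b : PFhat_type m c') f (val b)) *+ m.+1 * m.+1%:R =
    m.+1%:R ^+ m.+1 *+ (a == a').
  rewrite -(@sum_PFhat m F c' f ft).
  transitivity (\sum_(t < m.+1) \sum_(w : word m)
      gauss_word (w - translate t (val a)) / gauss_word (w - val a')); last first.
    under eq_bigr do rewrite sum_gauss_word_ratio.
    (* By Pollak uniqueness, a translate of a equals a' only when a = a' and the shift is 0. *)
    have [<- | naa'] := eqVneq a a'.
      rewrite (bigD1 0) //= translate0 eqxx big1 ?addr0 // => t /eqP t0.
      case: eqP => // ta; case: t0.
      apply: (@pollak_unique _ (val a)); last by rewrite translate0 PFhat_parking.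
      by rewrite ta PFhat_parking.
    apply: big1 => t _; case: eqP => // ta; case/eqP: naa'; apply: val_inj.
    rewrite -ta; apply/esym/parking_translate_eq; first exact: PFhat_parking.
    by rewrite ta PFhat_parking.
  rewrite exchange_big /= mulr_suml big_mkcond /=; apply: eq_bigr => w _.
  have sub0 t : w - translate t (val a) = translate (- t) (w - val a).
    by rewrite -{1}(translate0 w) translateB sub0r.
  rewrite [RHS](reindex_inj (@oppr_inj _)) /=.
  under [RHS] eq_bigr do rewrite sub0 opprK gauss_word_translate mulrAC.
  rewrite -mulr_sumr sum_add_charX sum_word_sub PFhat_sum.
  (* As h = -h mod n, the character is trivial exactly when w has sum c'. *)
  rewrite -(addr0_eq hh) -addrA -opprD -cc' subr_eq0.
  by case: eqP => _; rewrite ?mulr0.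
rewrite -mulr_natr => E; apply: (mulIf n0); apply: (mulIf n0).
by rewrite E !mulrnAl -mulrA -expr2 divfK // expf_neq0.
Qed.

End GaussKernel.

(** * Isomorphisms between the representations *)

Section Isomorphisms.
Variables (R : realType) (m : nat).

Lemma tau_rsim_kernel c c' (K : PFhat_type m c -> PFhat_type m c' -> R[i]%C)
    (K' : PFhat_type m c' -> PFhat_type m c -> R[i]%C) :
  row_free (kernel_mx K) -> row_free (kernel_mx K') ->
  (forall p a b, K (tau_act p a) (tau_act p b) = K a b) ->
  mx_rsim (tau R m c) (tau R m c').
Proof.
move=> fK fK' Kp; apply: (mx_rsim_of_row_free fK fK') => p _ /=.
apply: kernel_mx_intertwines; last exact: Kp.
- exact: tau_act1.
- exact: tau_actM.
Qed.

Lemma scale_PFhat_row_free u c c' (co_u : coprime u m.+1)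
    (cc' : (c * u = c' %[mod m.+1])%N) :
  row_free (kernel_mx (fun a b => (scale_PFhat cc' a == b)%:R : R[i]%C)).
Proof.
apply: (@kernel_mx_row_free _ _ _ _ (fun b a => (scale_PFhat cc' a == b)%:R) 1).
  exact: oner_neq0.
move=> a a'; rewrite (bigD1 (scale_PFhat cc' a)) //= eqxx mul1r.
rewrite (inj_eq (@scale_PFhat_inj _ _ _ _ co_u cc')) eq_sym big1 ?addr0 // => b.
by rewrite eq_sym => /negPf->; rewrite mul0r.
Qed.

Lemma tau_rsim_gcdn c c' :
  gcdn m.+1 c = gcdn m.+1 c' -> mx_rsim (tau R m c) (tau R m c').
Proof.
move=> e; have [u co_u cu] := eq_gcdn_unit (ltn0Sn m) e.
have [v co_v cv] := eq_gcdn_unit (ltn0Sn m) (esym e).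
apply: (tau_rsim_kernel (scale_PFhat_row_free co_u cu)
                        (scale_PFhat_row_free co_v cv)) => p a b.
by rewrite -tau_act_scale_PFhat (can_eq (@tau_actK _ _ p)).
Qed.

Lemma tau_rsim_half h c : m.+1 = h.*2 -> mx_rsim (tau R m c) (tau R m (c + h)).
Proof.
move=> mh; have [z pz] : exists z : R[i]%C, (m.+1.*2).-primitive_root z.
  by apply: closed_prim_root; rewrite pnatr_eq0.
(* The relation between d and d' is symmetric, so this gives row-free kernels in both directions and
   hence equal dimensions. *)
have free d d' : inZp d' = inZp d + inZp h :> 'I_m.+1 ->
    row_free (kernel_mx (@gauss_kernel _ m z d d')).
  move=> dd'; apply: (kernel_mx_row_free _ (sum_gauss_kernel mh pz dd')).
  by rewrite mulf_neq0 ?invr_eq0 // expf_neq0 // pnatr_eq0.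
have e1 : inZp (c + h) = inZp c + inZp h :> 'I_m.+1.
  by apply: val_inj; rewrite /= modnDm.
have e2 : inZp c = inZp (c + h) + inZp h :> 'I_m.+1.
  by apply: val_inj; rewrite /= modnDm -addnA addnn -mh modnDr.
apply: (tau_rsim_kernel (free _ _ e1) (free _ _ e2)) => p a b.
exact: (gauss_kernel_tau_act mh pz e1).
Qed.

End Isomorphisms.

(** * Fixed points of the block rotation *)

Section FixedPoints.
Variables (m k : nat).
Hypothesis kD : k \in D m.+1.
Let d := (m.+1 %/ k)%N.

Let mE : m.+1 = (k * d)%N.
Proof. by case/and3P: kD => _ kn _; rewrite mulnC divnK. Qed.

Let k_gt0 : (0 < k)%N. Proof. by case/and3P: kD. Qed.

Let d_gt0 : (0 < d)%N. Proof. by move: (ltn0Sn m); rewrite mE muln_gt0 => /andP[]. Qed.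

Definition block_shift : 'S_m.+1 := perm (addIr (inZp d : 'I_m.+1)).

(** Cut the positions into k blocks of length d: block q is block 0 with q y added to each entry. *)
Lemma sum_block_shift (x : word m) (y : 'I_m.+1) :
  (forall i, x (block_shift i) = x i + y) ->
  \sum_i x i = (\sum_(r < d) x (inZp r)) *+ k + y *+ (d * \sum_(q < k) q).
Proof.
move=> xs.
have xq q r : x (inZp (q * d + r)) = x (inZp r) + y *+ q.
  elim: q => [|q IH]; first by rewrite mulr0n addr0.
  rewrite mulrSr addrA -IH -xs permE; congr (x _); apply: val_inj => /=.
  by rewrite modnDm; congr (_ %% _)%N; lia.
transitivity (\sum_(0 <= j < k * d) x (inZp j)).
  by rewrite -mE big_mkord; apply: eq_bigr => i _; rewrite valZpK.
rewrite big_nat_mul big_mkord.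
transitivity (\sum_(q < k) (\sum_(r < d) x (inZp r) + y *+ q *+ d)).
  apply: eq_bigr => q _; rewrite -{1}[(q * d)%N]add0n big_addn mulSn addnK big_mkord.
  under eq_bigr do rewrite addnC xq.
  by rewrite big_split /= sumr_const card_ord.
rewrite big_split /= sumr_const card_ord; congr (_ + _).
by rewrite sumrMnl sumrMnr mulnC mulrnA.
Qed.

(** For odd k, k divides k(k-1)/2. For even k, n is even, so d is even by [kD] and the product is
    (d/2) k (k-1). *)
Lemma dvdn_mul_triangular : (k %| d * \sum_(q < k) q)%N.
Proof.
have T2 : ((\sum_(q < k) q).*2 = k * k.-1)%N.
  elim: k => [|j IH]; first by rewrite big_ord0.
  by rewrite big_ord_recr /= doubleD IH; case: j {IH} => //= j; lia.
case/and3P: kD => _ _ /eqP dn; rewrite -/d mE !modn2 oddM in dn.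
case: (boolP (odd k)) => ok.
  have : (k %| (\sum_(q < k) q).*2)%N by rewrite T2 dvdn_mulr.
  by rewrite -mul2n Gauss_dvdr ?coprimen2 // => /dvdn_mull->.
have /negbTE od : ~~ odd d by move: dn; rewrite (negPf ok); case: (odd d).
rewrite -[d]odd_double_half od add0n -doubleMl doubleMr T2.
by rewrite dvdn_mull // dvdn_mulr.
Qed.

Lemma block_shift_fixed_point c :
  [exists a : PFhat_type m c, tau_act block_shift a == a] = (k %| c)%N.
Proof.
have kn : (k %| m.+1)%N by rewrite mE dvdn_mulr.
have dn : (d %| m.+1)%N by rewrite mE dvdn_mull.
apply/existsP/idP => [[a /eqP/(congr1 val) /= fa] | /dvdnP[e ce]].
  pose s := pollak_shift (permute block_shift (val a)).
  have /sum_block_shift : forall i, val a (block_shift i) = val a i - s.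
    by move=> i; have /ffunP/(_ i) <- := fa; rewrite !ffunE addrAC subrr add0r.
  rewrite PFhat_sum => /(congr1 val) /=; rewrite !Zp_mulrn /= modnDm => ec.
  suff : (k %| c %% m.+1)%N by rewrite /dvdn modn_dvdm.
  rewrite ec /dvdn modn_dvdm // -/(dvdn _ _).
  by apply: dvdn_add; apply: dvdn_mull; rewrite ?dvdn_mul_triangular.
(* A d-periodic word with k entries e, hence with sum k e = c. *)
pose x : word m := [ffun i : 'I_m.+1 => if (d %| i)%N then inZp e else 0].
have xs i : x (block_shift i) = x i.
  by rewrite !ffunE permE /= /dvdn modn_dvdm // -modnDmr modn_dvdm // modnn addn0.
have sx : \sum_i x i = inZp c.
  rewrite (@sum_block_shift x 0) => [|i]; last by rewrite addr0.
  rewrite mul0rn addr0 (bigD1 (Ordinal d_gt0)) //= big1 => [|r r0].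
    rewrite addr0 ffunE /= mod0n dvdn0 ce; apply: val_inj.
    by rewrite Zp_mulrn /= modnMml.
  rewrite ffunE /= modn_small; last by rewrite (leq_trans (ltn_ord r)) // dvdn_leq.
  rewrite gtnNdvd //; first by rewrite lt0n.
exists (Sub (normalize x) (normalize_PFhat sx)); apply/eqP/val_inj => /=.
rewrite /act_word -/(normalize _) {2}/normalize permute_translate normalize_translate.
by congr normalize; apply/ffunP => i; rewrite [LHS]ffunE xs.
Qed.

End FixedPoints.

(** * Recovering k from c, and the conclusion *)

(** In the case of gcd 2k, let 2k = t k' and n/k = 2(2q+1), so n/k' = t(2q+1). As n is even, k' in
    [D n] makes n/k' even, so t is even and k' divides k. *)
Lemma dvdn_C n k k' c :
  k \in D n -> k' \in D n -> c \in C n k -> (k' %| c)%N = (k' %| k)%N.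
Proof.
case/and3P=> k_gt0 kn dk /and3P[k'_gt0 k'n dk'] /andP[/andP[c_gt0 cn]].
have -> : (k' %| c)%N = (k' %| gcdn n c)%N by rewrite dvdn_gcd k'n.
case: ifP => [/eqP d2|_ /eqP-> //]; rewrite !inE => /orP[/eqP->//|/eqP->].
apply/idP/idP => [/dvdnP[t kt] | k'k]; last by rewrite dvdn_mull.
have [nE nE'] := (divnK kn, divnK k'n); move: d2 dk dk' nE nE'.
move: (n %/ k)%N (n %/ k')%N => d d' d2 dk dk' nE nE'.
have dd' : (d'.*2 = t * d)%N.
  by apply/eqP; rewrite -(eqn_pmul2r k'_gt0); apply/eqP; nia.
have [q dE] : exists q, d = q.*2.+1.*2 by exists (d %/ 4)%N; lia.
have /esym/negbT d'_even : false = odd d'.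
  by move: dk'; rewrite !modn2 -nE oddM dE odd_double => /eqP; case: (odd d').
have te : (d' = t * q.*2.+1)%N by lia.
have [w tE] : exists w, t = w.*2.
  exists t./2; rewrite even_halfK //.
  by move: d'_even; rewrite te oddM /= odd_double andbT.
by apply/dvdnP; exists w; rewrite tE in kt; nia.
Qed.

(** Here n = 2uk with u odd, h = uk and c = sk with s odd and prime to u; then s + u = 2w with w
    prime to u, and gcd(2uk, 2wk) = 2k. *)
Lemma gcdn_add_half n h k c :
  (0 < k)%N -> n = h.*2 -> (n %/ k = 2 %[mod 4])%N -> gcdn n c = k ->
  gcdn n (c + h) = (2 * k)%N.
Proof.
move=> k_gt0 nh d2 gk.
have [kn kc] : (k %| n)%N /\ (k %| c)%N by rewrite -gk dvdn_gcdl dvdn_gcdr.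
have nE := divnK kn; move: d2 nE; move: (n %/ k)%N => d d2 nE.
have [u uo dE] : exists2 u, odd u & d = u.*2 by exists d./2; lia.
have hE : h = (u * k)%N by nia.
case/dvdnP: kc gk => s -> {c}; rewrite -{1}nE hE -mulnDl -nE -!muln_gcdl dE.
move/eqP; rewrite -[X in _ == X]mul1n eqn_pmul2r // -/(coprime _ _) => co_us.
congr (_ * _)%N; move: co_us; rewrite -muln2 coprimeMl coprime2n => /andP[co_us so].
have [w sw] : exists w, (s + u = w * 2)%N.
  by exists (s + u)./2; rewrite muln2 even_halfK // oddD so uo.
rewrite sw -muln_gcdl; suff /eqP-> : coprime u w by [].
have : coprime u (s + u) by rewrite /coprime gcdnDr.
by rewrite sw coprimeMr => /andP[].
Qed.

Theorem theorem4p4 (R : realType) (m : nat) :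
  (forall k : nat, k \in D m.+1 ->
     forall c c' : nat, c \in C m.+1 k -> c' \in C m.+1 k ->
       mx_rsim (tau R m c) (tau R m c'))
  /\
  (forall k k' : nat, k \in D m.+1 -> k' \in D m.+1 -> k <> k' ->
     forall c c' : nat, c \in C m.+1 k -> c' \in C m.+1 k' ->
       ~ mx_rsim (tau R m c) (tau R m c')).
Proof.
split=> [k kD c c' cC c'C | k k' kD k'D nkk' c c' cC c'C rs].
  have [/andP[_ gc] /andP[_ gc']] := (cC, c'C).
  move: gc gc'; case: ifP => [/eqP d2 | _ /eqP gc /eqP gc']; last first.
    by apply: tau_rsim_gcdn; rewrite gc.
  have k_gt0 : (0 < k)%N by case/and3P: kD.
  have [h mh] : exists h, m.+1 = h.*2.
    case/and3P: kD => _ _ /eqP dk; exists m.+1./2; lia.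
  have sim b b' : gcdn m.+1 b = k -> gcdn m.+1 b' = (2 * k)%N ->
      mx_rsim (tau R m b) (tau R m b').
    move=> gb gb'; apply: mx_rsim_trans (tau_rsim_half R b mh) _.
    by apply: tau_rsim_gcdn; rewrite gb' (gcdn_add_half k_gt0 mh d2 gb).
  rewrite !inE => /orP[]/eqP gc /orP[]/eqP gc'.
  - by apply: tau_rsim_gcdn; rewrite gc.
  - exact: sim.
  - by apply: mx_rsim_sym; apply: sim.
  - by apply: tau_rsim_gcdn; rewrite gc.
(* Applied to j = k and j = k', this makes k and k' divide each other. *)
case: nkk'; suff dvdE j : j \in D m.+1 -> (j %| k)%N = (j %| k')%N.
  by apply/eqP; rewrite eqn_dvd -(dvdE k) // dvdnn dvdE // dvdnn.
have exE (T : finType) (P : pred T) : [exists x, P x] = (0 < #|[pred x | P x]|)%N.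
  by apply/existsP/card_gt0P => -[x Px]; exists x.
move=> jD; rewrite -(dvdn_C kD jD cC) -(dvdn_C k'D jD c'C).
rewrite -!(block_shift_fixed_point jD) !exE.
(* The characters count fixed points, and these counts can be compared in characteristic 0. *)
have /eqP := mx_rsim_mxtrace rs (in_setT (block_shift m j)).
by rewrite !mxtrace_left_perm_mx eqr_nat => /eqP->.
Qed.
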